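(* Let $d\ge 2$, and let $a=(a_0,a_1,a_2,\ldots)$ be an eventually periodic binary sequence (with entries in $\mathbb F_2$). For each $h\ge 0$ let $\varepsilon_h$ be the depth-dependent labeling of the complete rooted $d$-ary tree $T_h^{(d)}$ induced by $a$. Then the sequence of boundary affine subspaces \[ L_{T_h^{(d)}}\subseteq\mathbb F_2^2\qquad(h=0,1,2,\ldots) \] is eventually periodic in $h$. Moreover, there exist integers $h_0\ge 0$ and $p\ge 1$ such that, for each residue class $r$ modulo $p$, there are rational constants $c_r,b_r$ satisfying \[ \operatorname{null} M(T_h^{(d)},\varepsilon_h)=c_r d^h+b_r \] for all $h\ge h_0$ with $h\equiv r\pmod p$.
   Context: All matrices and vector spaces are over the two-element field $\mathbb F_2$, and $\operatorname{null}(M)=\dim\ker(M)$. $T_h^{(d)}$ is the complete rooted $d$-ary tree of height $h$: every non-leaf vertex has exactly $d$ children and every root-to-leaf path has length $h$. The depth-dependent labeling $\varepsilon_h$ of $T_h^{(d)}$ associated with $a$ assigns label $a_j$ to every vertex whose descendant subtree has height $j$; thus leaves receive label $a_0$, their parents $a_1$, and the root $a_h$. For a finite rooted tree $T$ with root $r$ and labeling $\varepsilon:V(T)\to\mathbb F_2$, put $M(T,\varepsilon)=A(T)+D_\varepsilon$, where $A(T)$ is the adjacency matrix over $\mathbb F_2$ and $D_\varepsilon$ is the diagonal matrix with diagonal vector $\varepsilon$, and for $\alpha,\beta\in\mathbb F_2$ define \[ N_T(\alpha,\beta)=\#\{x\in\mathbb F_2^{V(T)} : M(T,\varepsilon)x=\varepsilon+\alpha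 e_r,\ x_r=\beta\}, \] with $e_r$ the standard basis vector at $r$. The boundary affine subspace of $T$ (with labeling $\varepsilon$) is $L_T=\{(\alpha,\beta)\in\mathbb F_2^2 : N_T(\alpha,\beta)\neq 0\}$; it is a nonempty affine subspace of $\mathbb F_2^2$, and there is an integer $k\ge 0$ with $N_T(\alpha,\beta)=2^k$ for all $(\alpha,\beta)\in L_T$. Here $L_{T_h^{(d)}}$ is taken with respect to the labeling $\varepsilon_h$. A sequence $(s_h)_{h\ge 0}$ is eventually periodic if there are $H\ge 0$ and $q\ge 1$ with $s_{h+q}=s_h$ for all $h\ge H$. *)

(* Defs.v *)
From HB Require Import structures.
From mathcomp Require Import all_boot all_order all_algebra.

Set Implicit Arguments.
Unset Strict Implicit.
Unset Printing Implicit Defensive.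

Import GRing.Theory.
Local Open Scope ring_scope.

Definition eventually_periodic (T : Type) (s : nat -> T) : Prop :=
  exists H q : nat,
    (1 <= q)%N /\ forall h : nat, (H <= h)%N -> s (h + q)%N = s h.

(* Matrices and vectors indexed by a finite type V are indexed by 'I_#|V|
   through enum_val / enum_rank.  The definitions below are meant for a tree
   with vertex type V, adjacency relation e, root r and labeling eps, but
   make sense for every finite rooted graph. *)

Definition adj_mx (V : finType) (e : rel V) : 'M['F_2]_#|V| :=
  \matrix_(i, j) (e (enum_val i) (enum_val j))%:R.

Definition label_col (V : finType) (eps : V -> 'F_2) : 'cV['F_2]_#|V| :=
  \col_i eps (enum_val i).

Definition label_mx (V : finType) (e : rel V) (eps : V -> 'F_2) :
    'M['F_2]_#|V| :=
  adj_mx e + diag_mx (label_col eps)^T.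

Definition nullity (n : nat) (M : 'M['F_2]_n) : nat :=
  \dim (lker (linfun (mulmx M : 'cV['F_2]_n -> 'cV['F_2]_n))).

Definition boundary_count (V : finType) (e : rel V) (r : V)
    (eps : V -> 'F_2) (alpha beta : 'F_2) : nat :=
  #|[set x : 'cV['F_2]_#|V| |
      (label_mx e eps *m x
         == label_col eps + alpha *: delta_mx (enum_rank r) 0)
      && (x (enum_rank r) 0 == beta)]|.

Definition boundary_space (V : finType) (e : rel V) (r : V)
    (eps : V -> 'F_2) : {set 'F_2 * 'F_2} :=
  [set p | boundary_count e r eps p.1 p.2 != 0%N].

(* Vertices of the complete d-ary tree of height h are the words of length
   at most h over 'I_d; the root is the empty word and the children of a
   vertex are its one-letter extensions on the right. *)

Definition dtree (d h : nat) : finType := h.-bseq 'I_d.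

Definition dtree_root (d h : nat) : dtree d h := [bseq].

Definition dtree_child (d h : nat) (u v : dtree d h) : bool :=
  [exists i : 'I_d, (v : seq 'I_d) == rcons u i].

Definition dtree_adj (d h : nat) : rel (dtree d h) :=
  fun u v => dtree_child u v || dtree_child v u.

(* All leaves have depth h, so the subtree of descendants of a vertex of
   depth k has height h - k. *)
Definition subtree_height (d h : nat) (v : dtree d h) : nat :=
  (h - size v)%N.

Definition depth_label (a : nat -> 'F_2) (d h : nat) : dtree d h -> 'F_2 :=
  fun v => a (subtree_height v).
Arguments depth_label a d h v : clear implicits.
Arguments dtree_adj : clear implicits.
Arguments dtree_root : clear implicits.

Definition dtree_mx (a : nat -> 'F_2) (d h : nat) : 'M['F_2]_#|dtree d h| :=
  label_mx (dtree_adj d h) (depth_label a d h).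

Definition dtree_boundary (a : nat -> 'F_2) (d h : nat) : {set 'F_2 * 'F_2} :=
  boundary_space (dtree_adj d h) (dtree_root d h) (depth_label a d h).

(* Main.v *)
(* Deleting the root of T_(h+1) leaves d copies of T_h, so N_(h+1)(alpha, beta)
   is the sum, over the d-tuples g of root values with
   sum g + a_(h+1) beta = a_(h+1) + alpha, of the products of the
   N_h(beta, g_i).  Starting from the line alpha + a_0 beta = a_0, this
   recursion preserves the form
     N_h(alpha, beta) = 2^k [l alpha + m beta = l m],  where m = 0 -> l = 1,
   and (l, m) evolves by a map depending only on a_(h+1); this is a finite
   state system driven by an eventually periodic input.
   The solutions of M x = eps form a coset of ker M and are counted by
   N_h(0, 0) + N_h(0, 1), whence null = k + [m = 0].  Thus null satisfies
   null_(h+1) = d null_h + s_h with s eventually periodic. *)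

Require Import Defs.
From HB Require Import structures.
From mathcomp Require Import all_boot all_order all_algebra.
From mathcomp Require Import finfield ring.

Set Implicit Arguments.
Unset Strict Implicit.
Unset Printing Implicit Defensive.

Import GRing.Theory.
Local Open Scope ring_scope.

(** * Eventually periodic sequences and recurrences driven by them *)

Lemma eventually_periodic_muln (T : Type) (s : nat -> T) (H q : nat) :
  (forall h, (H <= h)%N -> s (h + q)%N = s h) ->
  forall n h, (H <= h)%N -> s (h + n * q)%N = s h.
Proof.
move=> sP; elim=> [|n IHn] h Hh; first by rewrite addn0.
by rewrite mulSnr addnA sP ?IHn // (leq_trans Hh) ?leq_addr.
Qed.

(** The times [H + i * q] all see the same phase of the input, so by pigeonhole two of them carry
    equal states, and from there the futures coincide. *)
Lemma eventually_periodic_driven (S : finType) (A : Type) (phi : A -> S -> S)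
    (a : nat -> A) (x : nat -> S) :
  eventually_periodic a -> (forall h, x h.+1 = phi (a h.+1) (x h)) ->
  eventually_periodic x.
Proof.
move=> [H [q [q_gt0 aP]]] xS; pose y (i : 'I_#|S|.+1) := x (H + i * q)%N.
have /injectivePn[i [j ne_ij yij]] : ~~ injectiveb y.
  apply/negP=> /injectiveP/leq_card.
  by rewrite card_ord ltnn.
wlog ltij : i j ne_ij yij / (i < j)%N.
  move=> IH; have:= ne_ij; rewrite -val_eqE neq_ltn => /orP[] lt_ij.
    exact: (IH i j).
  by apply: (IH j i); rewrite // eq_sym.
exists (H + i * q)%N, ((j - i) * q)%N; split.
  by rewrite muln_gt0 subn_gt0 ltij.
move=> h /subnKC <-; elim: (h - _)%N => [|n IHn].
  by rewrite addn0 -addnA -mulnDl subnKC 1?ltnW.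
rewrite addnS addSn !xS IHn; congr phi.
by rewrite -addSn (eventually_periodic_muln aP) // leqW // -addnA leq_addr.
Qed.

(** Along a residue class modulo [q], far enough out, [q] steps of the recurrence amount to one
    fixed affine map with multiplier [D]. As [D] is not 1, that map is a scaling about its fixed
    point. *)
Lemma affine_recurrence_closed_form (d : nat) (s u : nat -> rat) :
  (2 <= d)%N -> eventually_periodic s ->
  (forall h, u h.+1 = d%:R * u h + s h) ->
  exists h0 p : nat, (1 <= p)%N /\
    forall r : nat, (r < p)%N ->
      exists c b : rat, forall h : nat, (h0 <= h)%N -> h = r %[mod p] ->
        u h = c * d%:R ^+ h + b.
Proof.
move=> d_ge2 [H [q [q_gt0 sP]]] uS.
(* The forcing accumulated during [n] steps that start at [h]. *)
pose B n h := iteri n (fun i x => d%:R * x + s (h + i)%N) 0.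
have uB n h : u (h + n)%N = d%:R ^+ n * u h + B n h.
  elim: n => [|n IHn]; first by rewrite addn0 expr0 mul1r addr0.
  by rewrite addnS uS IHn exprS /=; ring.
have BP n h : (H <= h)%N -> B n (h + q)%N = B n h.
  move=> Hh; elim: n => //= n ->; congr (_ + _).
  by rewrite addnAC sP // (leq_trans Hh) ?leq_addr.
pose D : rat := d%:R ^+ q.
have D_neq1 : D - 1 != 0.
  rewrite /D -natrX subr_eq0 -[1]/(1%:R) Num.Theory.eqr_nat.
  by rewrite neq_ltn orbC -[1%N](exp1n q) ltn_exp2r ?d_ge2.
have d_neq0 : d%:R != 0 :> rat by rewrite Num.Theory.pnatr_eq0 -lt0n ltnW.
(* The bound is a multiple of [q], so [h1] lies in the class of [r], and it is past [H]. *)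
exists (H * q)%N, q; split=> // r lt_rq; pose h1 := (H * q + r)%N.
have Hh1 : (H <= h1)%N by rewrite (leq_trans _ (leq_addr _ _)) // leq_pmulr.
(* [b] is the fixed point of [x |-> D x + B q h1], the map taking [u h] to
   [u (h + q)] on the residue class of [r]. *)
pose b := - (B q h1 / (D - 1)).
exists ((u h1 - b) / d%:R ^+ h1), b => h h_ge hr.
have -> : h = (h1 + (h %/ q - H) * q)%N.
  rewrite {1}(divn_eq h q) hr (modn_small lt_rq) mulnBl addnAC subnKC //.
  by rewrite leq_mul2r leq_divRL ?h_ge ?orbT.
elim: (h %/ q - H)%N => [|n IHn].
  by rewrite addn0 divfK ?expf_neq0 // subrK.
rewrite mulSnr addnA uB IHn (eventually_periodic_muln (BP q)) //.
rewrite [_ ^+ (_ + q)]exprD -/D.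
have -> : B q h1 = b - D * b by rewrite /b; field.
by ring.
Qed.

(** * Counting solutions over the two-element field *)

Lemma F2P (x : 'F_2) : x = 0 \/ x = 1.
Proof. by case: x => [[|[|//]] ?]; [left | right]; apply: val_inj. Qed.

(** A nonempty fiber is the translate of the kernel by any of its points. *)
Lemma card_mulmx_fiber (n : nat) (M : 'M['F_2]_n) (z : 'cV['F_2]_n) :
  [exists x : 'cV['F_2]_n, M *m x == z] ->
  #|[set x : 'cV['F_2]_n | M *m x == z]| = (2 ^ nullity M)%N.
Proof.
move=> /existsP[x0 /eqP <-].
transitivity #|lker (linfun (mulmx M : 'cV_n -> 'cV_n))|; last first.
  by rewrite card_vspace card_Fp.
rewrite -[RHS](card_imset _ (addrI x0)); apply: eq_card => x; rewrite !inE.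
apply/eqP/imsetP=> [Mx | [y + ->]].
  exists (x - x0); last by rewrite addrC subrK.
  by rewrite memv_ker lfunE /= mulmxBr Mx subrr.
by rewrite memv_ker lfunE /= mulmxDr => /eqP->; rewrite addr0.
Qed.

(* The equation M x = eps + alpha e_r, read vertex by vertex. *)
Definition boundary_solution (V : finType) (e : rel V) (r : V)
    (eps : V -> 'F_2) (alpha : 'F_2) (f : V -> 'F_2) : bool :=
  [forall v, \sum_w (e v w)%:R * f w + eps v * f v
               == eps v + alpha * (v == r)%:R].

(** Passing from columns to functions on vertices rids the tree recursion of [enum_rank]. *)
Lemma boundary_countE (V : finType) (e : rel V) (r : V) (eps : V -> 'F_2)
    (alpha beta : 'F_2) :
  boundary_count e r eps alpha beta =
    #|[set f : {ffun V -> 'F_2} |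
        boundary_solution e r eps alpha f && (f r == beta)]|.
Proof.
pose col (f : {ffun V -> 'F_2}) : 'cV['F_2]_#|V| := \col_i f (enum_val i).
have col_bij : bijective col.
  exists (fun x : 'cV_#|V| => [ffun v => x (enum_rank v) 0]) => x.
    by apply/ffunP=> v; rewrite !ffunE mxE enum_rankK.
  by apply/colP=> i; rewrite !mxE ffunE enum_valK.
rewrite /boundary_count -(on_card_preimset (onW_bij _ col_bij)).
apply: eq_card => f; rewrite !inE mxE enum_rankK; congr (_ && _).
have row i : (label_mx e eps *m col f) i 0 =
    \sum_w (e (enum_val i) w)%:R * f w + eps (enum_val i) * f (enum_val i).
  rewrite mulmxDl mul_diag_mx !mxE; congr (_ + _).
  rewrite (big_enum_val (A := V)) /=.
  by apply: eq_bigr => j _; rewrite !mxE.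
apply/eqP/forallP => [Mf v | Mf].
  have /colP/(_ (enum_rank v)) := Mf; rewrite row !mxE enum_rankK => ->.
  by rewrite eqxx andbT (inj_eq enum_rank_inj).
apply/colP => i; rewrite row (eqP (Mf _)) !mxE eqxx andbT.
by rewrite -(inj_eq enum_rank_inj) enum_valK.
Qed.

(** * Decomposition of the tree at its root *)

(** Embeds the smaller tree as the branch below child [i] of the new root. Children are formed at
    the other end of the word, so adjacency inside a branch is preserved. *)
Definition dtree_cons (d h : nat) (i : 'I_d) (w : dtree d h) : dtree d h.+1 :=
  [bseq of i :: w].

Lemma dtree_cons_inj (d h : nat) (i j : 'I_d) (v w : dtree d h) :
  (dtree_cons i v == dtree_cons j w) = (i == j) && (v == w).
Proof. by rewrite -val_eqE /= eqseq_cons. Qed.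

Lemma dtree_cons_neq_root (d h : nat) (i : 'I_d) (w : dtree d h) :
  (dtree_cons i w == dtree_root d h.+1) = false.
Proof. by rewrite -val_eqE. Qed.

Lemma dtreeSP (d h : nat) (v : dtree d h.+1) :
  v = dtree_root d h.+1 \/ exists i w, v = dtree_cons (h := h) i w.
Proof.
case: v => [[|i w] le_w]; [left | right; exists i, (Bseq (le_w : size w <= h)%N)];
by apply: val_inj.
Qed.

Lemma sum_dtreeS (d h : nat) (F : dtree d h.+1 -> 'F_2) :
  \sum_v F v = F (dtree_root d h.+1) + \sum_i \sum_w F (dtree_cons i w).
Proof.
rewrite (bigD1 (dtree_root d h.+1)) //=; congr (_ + _).
rewrite pair_big /=.
(* The partial inverse of [dtree_cons], undefined exactly at the root. *)
pose split (v : dtree d h.+1) : option ('I_d * dtree d h) :=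
  if v : seq _ is i :: _ then Some (i, [bseq of behead v]) else None.
have consK i w : split (dtree_cons i w) = Some (i, w).
  by congr (Some (_, _)); apply: val_inj.
rewrite (reindex_omap (fun p => dtree_cons p.1 p.2) split) => [|v].
  by apply: eq_bigl => -[i w]; rewrite dtree_cons_neq_root consK eqxx.
by case: (dtreeSP v) => [->|[i [w ->]]]; rewrite ?eqxx // consK.
Qed.

Lemma dtree_adj_root_cons (d h : nat) (i : 'I_d) (w : dtree d h) :
  dtree_adj d h.+1 (dtree_root d h.+1) (dtree_cons i w) = (w == dtree_root d h).
Proof.
rewrite /dtree_adj /dtree_child -val_eqE /=; apply/orP/eqP => [|->].
  by case=> /existsP[j]; rewrite ?eqseq_cons // => /andP[_ /eqP].
by left; apply/existsP; exists i.
Qed.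

Lemma dtree_adj_cons (d h : nat) (i j : 'I_d) (v w : dtree d h) :
  dtree_adj d h.+1 (dtree_cons i v) (dtree_cons j w)
    = (i == j) && dtree_adj d h v w.
Proof.
have child k l (x y : dtree d h) :
    dtree_child (dtree_cons k x) (dtree_cons l y) = (k == l) && dtree_child x y.
  rewrite /dtree_child /= eq_sym; have [-> | ne_kl] := eqVneq l k.
    by apply: eq_existsb => m; rewrite eqseq_cons eqxx.
  by apply/existsP=> -[m]; rewrite eqseq_cons (negPf ne_kl).
by rewrite /dtree_adj !child [j == i]eq_sym -andb_orr.
Qed.

Lemma dtree_adj_sym (d h : nat) : symmetric (dtree_adj d h).
Proof. by move=> v w; rewrite /dtree_adj orbC. Qed.

Lemma dtree_adj_root (d h : nat) :
  dtree_adj d h (dtree_root d h) (dtree_root d h) = false.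
Proof. by rewrite /dtree_adj orbb; apply/existsP=> -[]. Qed.

(** In the row of a branch root, the value at the new root is an extra summand. Moved to the
    right-hand side, it plays the role of [alpha] for that branch. *)
Lemma boundary_solution_dtreeS (a : nat -> 'F_2) (d h : nat) (alpha : 'F_2)
    (f : dtree d h.+1 -> 'F_2) :
  boundary_solution (dtree_adj d h.+1) (dtree_root d h.+1)
      (depth_label a d h.+1) alpha f =
    (\sum_i f (dtree_cons i (dtree_root d h)) + a h.+1 * f (dtree_root d h.+1)
       == a h.+1 + alpha) &&
    [forall i, boundary_solution (dtree_adj d h) (dtree_root d h)
       (depth_label a d h) (f (dtree_root d h.+1))
       (fun w => f (dtree_cons i w))].
Proof.
have rootE : \sum_w (dtree_adj d h.+1 (dtree_root d h.+1) w)%:R * f w =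
    \sum_i f (dtree_cons i (dtree_root d h)).
  rewrite sum_dtreeS dtree_adj_root mul0r add0r; apply: eq_bigr => i _.
  rewrite (bigD1 (dtree_root d h)) //= dtree_adj_root_cons eqxx mul1r.
  rewrite big1 ?addr0 // => w /negPf ne_w.
  by rewrite dtree_adj_root_cons ne_w mul0r.
have consE i v : \sum_w (dtree_adj d h.+1 (dtree_cons i v) w)%:R * f w =
    f (dtree_root d h.+1) * (v == dtree_root d h)%:R +
    \sum_w (dtree_adj d h v w)%:R * f (dtree_cons i w).
  rewrite sum_dtreeS dtree_adj_sym dtree_adj_root_cons mulrC; congr (_ + _).
  rewrite (bigD1 i) //= [X in _ + X]big1 ?addr0 => [|j /negPf ne_j].
    by apply: eq_bigr => w _; rewrite dtree_adj_cons eqxx.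
  by apply: big1 => w _; rewrite dtree_adj_cons eq_sym ne_j mul0r.
(* The vertex gets one level deeper in a tree one level higher, so its subtree height stays the
   same. *)
have labelE i v : depth_label a d h.+1 (dtree_cons i v) = depth_label a d h v.
  by [].
have shiftE (b x y z : 'F_2) : (b + x + y == z + 0) = (x + y == z + b).
  by move: (F2P b) (F2P x) (F2P y) (F2P z) => [] -> [] -> [] -> [] ->.
apply/forallP/andP => [sol | [sol_r /forallP sol v]].
  split; first by have := sol (dtree_root d h.+1); rewrite rootE eqxx mulr1.
  apply/forallP=> i; apply/forallP=> v; have := sol (dtree_cons i v).
  by rewrite consE dtree_cons_neq_root mulr0 shiftE labelE.
have [-> | [i [w ->]]] := dtreeSP v; first by rewrite rootE eqxx mulr1.
rewrite consE dtree_cons_neq_root mulr0 shiftE labelE.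
exact: (forallP (sol i)).
Qed.

(** Once the root value is fixed, the branches interact only through the root equation, which sees
    nothing of them but their root values [g]. *)
Lemma boundary_count_dtreeS (a : nat -> 'F_2) (d h : nat) (alpha beta : 'F_2) :
  boundary_count (dtree_adj d h.+1) (dtree_root d h.+1) (depth_label a d h.+1)
      alpha beta =
    (\sum_(g : {ffun 'I_d -> 'F_2} |
           (\sum_i g i + a h.+1 * beta == a h.+1 + alpha)%R)
       \prod_i boundary_count (dtree_adj d h) (dtree_root d h)
                 (depth_label a d h) beta (g i))%N.
Proof.
pose T := {ffun dtree d h -> 'F_2}.
pose S (c : 'F_2) : {set T} := [set f : T | boundary_solution (dtree_adj d h)
  (dtree_root d h) (depth_label a d h) beta f && (f (dtree_root d h) == c)].
pose U := [set x : {ffun 'I_d -> T} |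
  (\sum_i x i (dtree_root d h) + a h.+1 * beta == a h.+1 + alpha)%R &&
  [forall i, boundary_solution (dtree_adj d h) (dtree_root d h)
               (depth_label a d h) beta (x i)]].
transitivity #|U|.
  (* Glues the [x i] below a new root of value [beta]. *)
  pose graft (x : {ffun 'I_d -> T}) : {ffun dtree d h.+1 -> 'F_2} :=
    [ffun v : dtree d h.+1 =>
       if v : seq _ is i :: _ then x i [bseq of behead v] else beta].
  have graft_root x : graft x (dtree_root d h.+1) = beta by rewrite ffunE.
  have graft_cons x i w : graft x (dtree_cons i w) = x i w.
    by rewrite ffunE /=; congr (x i _); apply: val_inj.
  have graft_inj : injective graft.
    move=> x y exy; apply/ffunP=> i; apply/ffunP=> w.
    by rewrite -!graft_cons exy.
  rewrite boundary_countE -(card_imset U graft_inj); apply: eq_card => f.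
  rewrite inE boundary_solution_dtreeS; apply/andP/imsetP.
    case=> /andP[sol_r sol] /eqP f_r.
    exists [ffun i => [ffun w => f (dtree_cons i w)]].
      rewrite inE -f_r; apply/andP; split.
        by under eq_bigr => i do rewrite !ffunE.
      apply/forallP=> i; have := forallP sol i; rewrite /boundary_solution.
      move=> /forallP sol_i; apply/forallP => v; have := sol_i v.
      by rewrite !ffunE; under [in X in _ -> X]eq_bigr => w do rewrite ffunE.
    apply/ffunP=> v; have [-> | [i [w ->]]] := dtreeSP v.
      by rewrite graft_root.
    by rewrite graft_cons !ffunE.
  case=> x; rewrite inE => /andP[sol_r /forallP sol] ->.
  rewrite graft_root eqxx; split=> //; apply/andP; split.
    by under eq_bigr => i do rewrite graft_cons.
  apply/forallP=> i; apply/forallP=> v; have := forallP (sol i) v.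
  rewrite graft_cons.
  by under [in X in _ -> X]eq_bigr => w do rewrite graft_cons.
(* Sort the tuples in [U] by their root values; the fiber over [g] is the product of the sets
   [S (g i)]. *)
pose rt (x : {ffun 'I_d -> T}) := [ffun i => x i (dtree_root d h)].
have rtE x : \sum_i rt x i = \sum_i x i (dtree_root d h).
  by apply: eq_bigr => i _; rewrite ffunE.
rewrite -sum1_card (partition_big rt (fun g : {ffun 'I_d -> 'F_2} =>
  \sum_i g i + a h.+1 * beta == a h.+1 + alpha)) => [|x]; last first.
  by rewrite inE rtE => /andP[].
apply: eq_bigr => g sum_g.
under [RHS]eq_bigr => i do rewrite boundary_countE -/(S (g i)).
rewrite sum1_card.
transitivity #|(family (fun i => mem (S (g i))) : simpl_pred {ffun 'I_d -> T})|.
  2: by rewrite card_family foldrE big_map big_enum.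
apply: eq_card => x; apply/andP/familyP => [|sol].
  case; rewrite inE => /andP[_ /forallP sol] /eqP <- i.
  by rewrite !inE sol ffunE eqxx.
have rt_x : rt x = g.
  apply/ffunP=> i; rewrite ffunE; have := sol i.
  by rewrite !inE => /andP[_ /eqP].
split; last exact/eqP; rewrite inE; apply/andP; split; first by rewrite -rtE rt_x.
by apply/forallP=> i; have := sol i; rewrite !inE => /andP[].
Qed.

(** * Boundary lines and their evolution *)

(** All coordinates but the first are free, and they determine the first. *)
Lemma card_ffun_sum (d : nat) (s : 'F_2) :
  #|[set g : {ffun 'I_d.+1 -> 'F_2} | \sum_i g i == s]| = (2 ^ d)%N.
Proof.
pose h (y : {ffun 'I_d -> 'F_2}) : {ffun 'I_d.+1 -> 'F_2} :=
  [ffun i => if unlift ord0 i is Some j then y j else s - \sum_j y j].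
have h0 y : h y ord0 = s - \sum_j y j by rewrite ffunE unlift_none.
have hS y j : h y (lift ord0 j) = y j by rewrite ffunE liftK.
have h_inj : injective h.
  by move=> y z eyz; apply/ffunP=> j; rewrite -!hS eyz.
transitivity #|{ffun 'I_d -> 'F_2}|; last by rewrite card_ffun card_Fp ?card_ord.
rewrite -(card_imset predT h_inj); apply: eq_card => g; rewrite inE.
apply/eqP/imsetP => [sum_g | [y _ ->]]; last first.
  by rewrite big_ord_recl h0 (eq_bigr _ (fun j _ => hS y j)) subrK.
exists [ffun j => g (lift ord0 j)] => //; apply/ffunP=> i.
have [j ->|->] := unliftP ord0 i; first by rewrite hS ffunE.
rewrite h0 -sum_g big_ord_recl; under [X in _ - X]eq_bigr => j _ do rewrite ffunE.
by rewrite addrK.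
Qed.

(** One formula for the three lines that occur: alpha = 0 for (1, 0), alpha + beta = 1 for (1, 1),
    beta = 0 for (0, 1). The pair (0, 0) would give the whole plane. *)
Definition boundary_line (l m : 'F_2) : {set 'F_2 * 'F_2} :=
  [set p | l * p.1 + m * p.2 == l * m].

Definition boundary_line_succ (d : nat) (a : 'F_2) (lm : 'F_2 * 'F_2) :
    'F_2 * 'F_2 :=
  if lm.2 == 0 then (0, 1) else (1, a + d%:R * lm.1).

(** If [m = 0], each branch forces [beta = 0] and leaves its root value free; the root equation then
    cuts the [d] free values down to [d.-1]. If [m = 1], [beta] determines every branch root value,
    and the root equation becomes the new line. *)
Lemma sum_prod_boundary_line (d k : nat) (l m a alpha beta : 'F_2) :
  (0 < d)%N -> (m = 0 -> l = 1) ->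
  (\sum_(g : {ffun 'I_d -> 'F_2} | (\sum_i g i + a * beta == a + alpha)%R)
     \prod_i (2 ^ k * ((beta, g i) \in boundary_line l m)))%N =
  (2 ^ (d * k + (m == 0%R) * d.-1) *
   ((alpha, beta) \in boundary_line (boundary_line_succ d a (l, m)).1
                                    (boundary_line_succ d a (l, m)).2))%N.
Proof.
move=> d_gt0 lm.
have prodE (g : {ffun 'I_d -> 'F_2}) :
    (\prod_i (2 ^ k * ((beta, g i) \in boundary_line l m)) =
     if [forall i, (beta, g i) \in boundary_line l m] then 2 ^ (d * k) else 0)%N.
  case: ifPn => [/forallP g_in | ].
    under eq_bigr => i _ do rewrite g_in muln1.
    by rewrite prod_nat_const card_ord -expnM mulnC.
  by rewrite negb_forall => /existsP[i /negPf g_i]; rewrite (bigD1 i) //= g_i muln0.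
under eq_bigr => g _ do rewrite prodE.
rewrite -big_mkcondr sum_nat_const /boundary_line_succ /= expnD mulnC -mulnA.
congr (_ * _)%N; case: (F2P m) lm => -> lm.
  rewrite eqxx mul1n (lm erefl) /= inE /= !mul0r add0r mul1r.
  case: d d_gt0 {prodE} => // d _ /=; have [-> | /negPf ne_beta] := eqVneq beta 0.
    rewrite muln1 -(card_ffun_sum d (a + alpha)).
    apply: eq_card => g; rewrite [RHS]inE unfold_in /= mulr0 addr0.
    apply: andb_idr => _.
    by apply/forallP=> i; rewrite inE /= !mul1r mul0r addr0.
  rewrite muln0; apply: eq_card0 => g; rewrite unfold_in /=; apply/andP=> -[_].
  by move=> /forallP/(_ ord0); rewrite inE /= !mul1r mul0r addr0 ne_beta.
(* Case [m = 1]: the branch line solved for its second coordinate gives [l * (1 + beta)], so [g0] is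
   the only tuple. *)
rewrite oner_eq0 mul0n mul1n /=; pose g0 : {ffun 'I_d -> 'F_2} := [ffun=> l * (1 + beta)].
have g0P (g : {ffun 'I_d -> 'F_2}) : [forall i, (beta, g i) \in boundary_line l 1] = (g == g0).
  have inP x : ((beta, x) \in boundary_line l 1) = (x == l * (1 + beta)).
    by rewrite inE /=; move: (F2P l) (F2P beta) (F2P x) => [] -> [] -> [] ->.
  apply/forallP/eqP => [g_in | -> i]; last by rewrite inP ffunE.
  by apply/ffunP=> i; rewrite ffunE; apply/eqP; rewrite -inP.
have g0_sum : \sum_i g0 i = d%:R * l * (1 + beta).
  under eq_bigr => i _ do rewrite ffunE.
  by rewrite sumr_const card_ord -mulrA mulr_natl.
have condE : (\sum_i g0 i + a * beta == a + alpha) =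
    ((alpha, beta) \in boundary_line 1 (a + d%:R * l)).
  rewrite g0_sum inE /=.
  by move: (F2P (d%:R * l)) (F2P alpha) (F2P beta) (F2P a)
    => [] -> [] -> [] -> [] ->.
rewrite -condE; case: (boolP (\sum_i g0 i + _ == _)) => [cond | /negPf cond].
  rewrite -[RHS](card1 g0); apply: eq_card => g; rewrite [RHS]inE unfold_in /= g0P.
  by apply: andb_idl => /eqP->.
apply: eq_card0 => g; rewrite unfold_in /= g0P.
by apply/andP=> -[] /[swap] /eqP->; rewrite cond.
Qed.

(** * Nullity of the complete trees *)

Lemma nullity_boundary_count (V : finType) (e : rel V) (r : V)
    (eps : V -> 'F_2) :
  let N := boundary_count e r eps in
  (0 < N 0%R 0%R + N 0%R 1%R)%N ->
  (2 ^ nullity (label_mx e eps) = N 0%R 0%R + N 0%R 1%R)%N.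
Proof.
move=> N N_gt0; set M := label_mx e eps.
pose Z : {set 'cV['F_2]_#|V|} := [set x | M *m x == label_col eps].
have cardZ : #|Z| = (N 0%R 0%R + N 0%R 1%R)%N.
  pose B : {set 'cV['F_2]_#|V|} :=
    [set x : 'cV['F_2]_#|V| | x (enum_rank r) 0 == 0].
  rewrite -(cardsID B); congr (_ + _)%N; apply: eq_card => x;
    rewrite !inE scale0r addr0 //.
  by rewrite andbC; case: (F2P (x (enum_rank r) 0)) => ->.
move: N_gt0; rewrite -cardZ => /card_gt0P[x] Mx; apply/esym/card_mulmx_fiber.
by move: Mx; rewrite inE => Mx; apply/existsP; exists x.
Qed.

Fixpoint dtree_line (a : nat -> 'F_2) (d h : nat) : 'F_2 * 'F_2 :=
  if h is h'.+1 then boundary_line_succ d (a h) (dtree_line a d h')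
  else (1, a 0%N).

(** The exponent k of the common value 2^k of the nonzero counts. *)
Fixpoint dtree_log_count (a : nat -> 'F_2) (d h : nat) : nat :=
  if h is h'.+1
  then d * dtree_log_count a d h' + ((dtree_line a d h').2 == 0%R) * d.-1
  else 0.

(** The invariant that keeps the state away from (0, 0). *)
Lemma dtree_line_eq0 (a : nat -> 'F_2) (d h : nat) :
  (dtree_line a d h).2 = 0 -> (dtree_line a d h).1 = 1.
Proof.
by case: h => //= h; rewrite /boundary_line_succ; case: ifP => // _ /eqP.
Qed.

Lemma dtree_boundary_countE (a : nat -> 'F_2) (d h : nat) (alpha beta : 'F_2) :
  (0 < d)%N ->
  boundary_count (dtree_adj d h) (dtree_root d h) (depth_label a d h) alpha beta
    = (2 ^ dtree_log_count a d h *
       ((alpha, beta) \in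
          boundary_line (dtree_line a d h).1 (dtree_line a d h).2))%N.
Proof.
move=> d_gt0; elim: h alpha beta => [|h IHh] alpha beta.
  (* At height 0 the single vertex has no neighbour, so only its label enters the equation. *)
  have dtree0 (v : dtree d 0) : v = dtree_root d 0 by apply: bseq0.
  have solE (f : {ffun dtree d 0 -> 'F_2}) :
      boundary_solution (dtree_adj d 0) (dtree_root d 0) (depth_label a d 0)
        alpha f = (a 0%N * f (dtree_root d 0) == a 0%N + alpha).
    have sum0 v : \sum_w (dtree_adj d 0 v w)%:R * f w = 0.
      by apply: big1 => w _; rewrite (dtree0 v) (dtree0 w) dtree_adj_root mul0r.
    apply/forallP/idP => [/(_ (dtree_root d 0)) | sol v].
      by rewrite sum0 add0r eqxx mulr1.
    by rewrite sum0 add0r (dtree0 v) eqxx mulr1.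
  have inE0 : ((alpha, beta) \in boundary_line 1 (a 0%N)) =
      (a 0%N * beta == a 0%N + alpha).
    rewrite inE /=.
    by move: (F2P (a 0%N)) (F2P alpha) (F2P beta) => [] -> [] -> [] ->.
  rewrite boundary_countE /= inE0 expn0; case: (boolP (_ == _)) => [cond | /negPf cond].
    rewrite muln1 -[RHS](card1 ([ffun=> beta] : {ffun dtree d 0 -> 'F_2})).
    apply: eq_card => f; rewrite !inE solE; apply/andP/eqP => [[_ /eqP f_r]|->].
      by apply/ffunP=> v; rewrite ffunE (dtree0 v).
    by rewrite ffunE eqxx.
  apply: eq_card0 => f; rewrite !inE solE.
  by apply/andP=> -[] /[swap] /eqP->; rewrite cond.
rewrite boundary_count_dtreeS /=.
under eq_bigr => g _ do under eq_bigr => i _ do rewrite IHh.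
rewrite (sum_prod_boundary_line _ _ _ _ d_gt0 (@dtree_line_eq0 a d h)).
by rewrite -surjective_pairing.
Qed.

Lemma dtree_boundaryE (a : nat -> 'F_2) (d h : nat) :
  (0 < d)%N ->
  dtree_boundary a d h =
    boundary_line (dtree_line a d h).1 (dtree_line a d h).2.
Proof.
move=> d_gt0; apply/setP=> -[alpha beta].
rewrite [LHS]inE dtree_boundary_countE //.
by case: (_ \in _); rewrite ?muln0 // muln1 -lt0n expn_gt0.
Qed.

(** The boundary line meets alpha = 0 in two points if [m = 0] and in one point if [m = 1]. *)
Lemma nullity_dtree_mx (a : nat -> 'F_2) (d h : nat) :
  (0 < d)%N ->
  nullity (dtree_mx a d h) =
    (dtree_log_count a d h + ((dtree_line a d h).2 == 0%R))%N.
Proof.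
move=> d_gt0.
have sumE : (boundary_count (dtree_adj d h) (dtree_root d h) (depth_label a d h) 0%R 0%R
    + boundary_count (dtree_adj d h) (dtree_root d h) (depth_label a d h) 0%R 1%R
    = 2 ^ (dtree_log_count a d h + ((dtree_line a d h).2 == 0%R)))%N.
  rewrite !dtree_boundary_countE // -mulnDr expnD; congr (_ * _)%N.
  rewrite !inE /=; have := @dtree_line_eq0 a d h; case: (dtree_line a d h) => l m /=.
  by move: (F2P l) (F2P m) => [] -> [] -> // /(_ erefl).
apply: (@expnI 2) => //.
by rewrite (nullity_boundary_count (r := dtree_root d h)) sumE // expn_gt0.
Qed.

(** The forcing depends only on two consecutive states, hence inherits their periodicity. It can be
    negative, so the identity is stated over [rat]. *)
Lemma nullity_dtree_mxS (a : nat -> 'F_2) (d h : nat) :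
  (0 < d)%N ->
  (nullity (dtree_mx a d h.+1))%:R =
    d%:R * (nullity (dtree_mx a d h))%:R +
    (((dtree_line a d h.+1).2 == 0)%:R - ((dtree_line a d h).2 == 0)%:R) :> rat.
Proof.
move=> d_gt0; rewrite !nullity_dtree_mx //=; case: d d_gt0 => // d _.
by rewrite /= -[d.+1]addn1 !(natrD, natrM); ring.
Qed.

Theorem theorem5p2 (d : nat) (hd : (2 <= d)%N)
    (a : nat -> 'F_2) (ha : eventually_periodic a) :
  eventually_periodic (fun h : nat => dtree_boundary a d h) /\
  exists h0 p : nat, (1 <= p)%N /\
    forall r : nat, (r < p)%N ->
      exists c b : rat, forall h : nat, (h0 <= h)%N -> h = r %[mod p] ->
        (nullity (dtree_mx a d h))%:R = c * d%:R ^+ h + b :> rat.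
Proof.
have d_gt0 : (0 < d)%N := ltnW hd.
have [H [q [q_gt0 lineP]]] : eventually_periodic (dtree_line a d).
  (* The states are pairs over ['F_2], hence finite in number. *)
  exact: (eventually_periodic_driven (phi := boundary_line_succ d) ha).
split.
  by exists H, q; split=> // h Hh; rewrite !dtree_boundaryE // lineP.
apply: (affine_recurrence_closed_form
  (u := fun h => (nullity (dtree_mx a d h))%:R) hd); last first.
  by move=> h; apply: nullity_dtree_mxS.
exists H, q; split=> // h Hh.
by rewrite -addSn !lineP // leqW.
Qed.
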